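(* Let $r\ge3$ be odd and work with coefficients in $\mathbb{Z}[1/\tilde r!]$. The linear map $\Phi\colon\mathrm{N}(\partial\triangle_+^{r-1})\to\overline{W}_*(r)$ defined below is a chain map.
   Context: $\tilde r=(r-1)/2$. $\mathbb{C}_r=\langle\rho\mid\rho^r\rangle$ is identified with $\{0,\dots,r-1\}$ (addition mod $r$); $N=\sum_j\rho^j$, $T=\rho-1$. $\mathrm{N}(\partial\triangle_+^{r-1})$: free module on symbols $[a_0,\dots,a_{q-1}]$ with distinct entries in $\{0,\dots,r-1\}$, $0\le q\le r-1$, in degree $q$ (the empty symbol $\emptyset$ in degree $0$), with $[a_{\pi(0)},\dots,a_{\pi(q-1)}]=(-1)^{\mathrm{sgn}\,\pi}[a_0,\dots,a_{q-1}]$ and $\partial[a_0,\dots,a_{q-1}]=\sum_i(-1)^i[a_0,\dots,\widehat{a_i},\dots,a_{q-1}]$. $\overline{W}_*(r)$: degree $0$ is the free module on $e_0$ with trivial $\mathbb{C}_r$-action; degree $q\ge1$ is the free $R[\mathbb{C}_r]$-module on $e_q$; $\partial(\rho^je_1)=e_0$, and for $q\ge2$, $\partial e_q=Te_{q-1}$ if $q$ is even, $\partial e_q=Ne_{q-1}$ if $q$ is odd. For $a,b\in\{0,\dots,r-1\}$ let $d(a,b)\in\{1,\dots,r\}$ be the integer congruent to $b-a$ mod $r$. A sequence $(a_0,\dots,a_{q-1})$ of distinct elements, $q\ge1$, is cyclically ordered if $\sum_{i=0}^{q-1}d(a_i,a_{i+1})=r$, where $a_q:=a_0$. Then $a_i$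 is called even (resp. odd) in the sequence if $d(a_i,a_{i+1})$ is even (resp. odd). Set $\phi_e(a,b)=\sum_{i=1}^{d(a,b)/2}\rho^{a+2i}$ if $d(a,b)$ is even, $0$ otherwise; $\phi_o(a,b)=\sum_{i=1}^{(d(a,b)-1)/2}\rho^{a+2i+1}$ if $d(a,b)$ is odd, $0$ otherwise. For a cyclically ordered sequence $A=(a_0,\dots,a_{q-1})$: $\Phi_e(A)=(-1)^{j+1}\phi_e(a_j,a_{j+1})e_q$ if $A$ has exactly one even entry $a_j$, and $0$ otherwise; $\Phi_o(A)=\sum_{j=0}^{q-1}\phi_o(a_j,a_{j+1})e_q$ if $A$ has no even entry, and $0$ otherwise. With $\varphi(q)=\lfloor(r-q-1)/2\rfloor$, set $\Phi(\emptyset)=e_0$, $\Phi(A)=\frac{\varphi(q)!}{\tilde r!}\Phi_e(A)$ for $q\ge2$ even, and $\Phi(A)=\frac{\varphi(q)!}{\tilde r!}\Phi_o(A)$ for $q$ odd. On a generator $[a_0,\dots,a_{q-1}]$, $\Phi$ is defined as $(-1)^{\mathrm{sgn}\,\pi}\Phi(a_{\pi(0)},\dots,a_{\pi(q-1)})$ for any permutation $\pi$ making $(a_{\pi(0)},\dots,a_{\pi(q-1)})$ cyclically ordered (the paper asserts this is independent of the choice), and extended linearly. *)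

(* Defs.v *)
From HB Require Import structures.
From mathcomp Require Import all_boot all_order all_algebra.
Set Implicit Arguments. Unset Strict Implicit. Unset Printing Implicit Defensive.
Import Order.TTheory GRing.Theory Num.Theory.
Local Open Scope ring_scope.

Definition fscale (R : comUnitRingType) (T : finType) (a : R) (f : {ffun T -> R})
  : {ffun T -> R} := [ffun t => a * f t].

Section Defs.
Variables (R : comUnitRingType) (r : nat).

Definition rtilde : nat := (r.-1)./2.
Definition varphi (q : nat) : nat := (r - q - 1)./2.

(* Elements of the group ring R[C_r]: coefficient vectors, x j = coeff of rho^j *)


Definition rho_pow (k : nat) : {ffun 'I_r -> R} := [ffun j : 'I_r => ((j : nat) == k %% r)%N%:R].

Definition gmul (x y : {ffun 'I_r -> R}) : {ffun 'I_r -> R} :=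
  [ffun j : 'I_r => \sum_(a : 'I_r) \sum_(b : 'I_r | ((a + b) %% r == j)%N) x a * y b].

Definition elT : {ffun 'I_r -> R} := rho_pow 1 - rho_pow 0.
Definition elN : {ffun 'I_r -> R} := [ffun _ => 1].

(* ---- the complex \overline W_*(r) ----
   degree 0 = R e_0 (represented by R), degree q >= 1 = R[C_r] e_q
   (represented by grp, x <-> x e_q). *)
Definition dW1 (x : {ffun 'I_r -> R}) : R := \sum_(j : 'I_r) x j.
Definition dW (q : nat) (x : {ffun 'I_r -> R}) : {ffun 'I_r -> R} := gmul x (if odd q then elN else elT).

(* ---- the complex N(\partial \triangle_+^{r-1}) ----
   the generator [a_0,...,a_{q-1}] with a_0 < ... < a_{q-1} is represented by
   the set {a_0,...,a_{q-1}}; a chain is a function {set 'I_r} -> R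
   (degree q part = coefficients on the sets of cardinality q). *)

Definition delta (B : {set 'I_r}) : {ffun {set 'I_r} -> R} := [ffun C => (C == B)%:R].

Definition bdN (A : {set 'I_r}) : {ffun {set 'I_r} -> R} :=
  \sum_(x in A) fscale ((-1 : R) ^+ (index x (enum A))) (delta (A :\ x)).
Definition dN (q : nat) (c : {ffun {set 'I_r} -> R}) : {ffun {set 'I_r} -> R} :=
  \sum_(A : {set 'I_r} | #|A| == q) fscale (c A) (bdN A).

(* d(a,b) in {1,..,r}, congruent to b - a mod r *)
Definition dist (a b : nat) : nat := if (a < b)%N then (b - a)%N else (b + r - a)%N.

Definition phi_e (a b : nat) : {ffun 'I_r -> R} :=
  if ~~ odd (dist a b) then \sum_(1 <= i < (dist a b)./2.+1) rho_pow (a + 2 * i)%N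
  else 0.
Definition phi_o (a b : nat) : {ffun 'I_r -> R} :=
  if odd (dist a b) then \sum_(1 <= i < ((dist a b).-1)./2.+1) rho_pow (a + 2 * i + 1)%N
  else 0.

(* for a sequence s = (a_0,..,a_{q-1}) of naturals (values of elements of C_r) *)
Definition nxt (s : seq nat) (i : nat) : nat := nth 0%N s (i.+1 %% size s)%N.
Definition step (s : seq nat) (i : nat) : nat := dist (nth 0 s i) (nxt s i).
Definition even_entries (s : seq nat) : seq nat :=
  [seq i <- iota 0 (size s) | ~~ odd (step s i)].

Definition Phi_e (s : seq nat) : {ffun 'I_r -> R} :=
  if even_entries s is [:: j] then fscale ((-1 : R) ^+ j.+1) (phi_e (nth 0 s j) (nxt s j))
  else 0.
Definition Phi_o (s : seq nat) : {ffun 'I_r -> R} :=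
  if even_entries s == [::] then \sum_(j < size s) phi_o (nth 0 s j) (nxt s j)
  else 0.

Definition Phi_seq (s : seq nat) : {ffun 'I_r -> R} :=
  fscale (((varphi (size s))`!)%:R / ((rtilde)`!)%:R)
    (if odd (size s) then Phi_o s else Phi_e s).

(* Phi on the generator [A] (entries in increasing order, which is cyclically
   ordered), degree q = #|A| >= 1 *)
Definition Phi_gen (A : {set 'I_r}) : {ffun 'I_r -> R} := Phi_seq [seq val x | x <- enum A].

Definition Phi (q : nat) (c : {ffun {set 'I_r} -> R}) : {ffun 'I_r -> R} :=
  \sum_(A : {set 'I_r} | #|A| == q) fscale (c A) (Phi_gen A).
Definition Phi0 (c : {ffun {set 'I_r} -> R}) : R := c set0.

End Defs.

(* Main.v *)
Require Import Defs.
From HB Require Import structures.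
From mathcomp Require Import all_boot all_order all_algebra.
From mathcomp Require Import zify ring.
Import Order.TTheory GRing.Theory Num.Theory.
Local Open Scope ring_scope.

Set Implicit Arguments.
Unset Strict Implicit.
Unset Printing Implicit Defensive.

(** Lift the cyclically ordered sequence to an increasing [a : nat -> nat] with
    [a (i + q) = a i + r], and let [F n] be the sum of the [rho^k], [k <= n],
    [k = n] mod 2.  Then [phi_e] and [phi_o] become the differences
    [F (a (i+1)) - F (a i)] and [F (a (i+1)) - F (a i + 1)], and deleting [a_i]
    merges two adjacent gaps, the merged gap being even iff the two gaps have
    the same parity.
    For [q] even the number of even gaps is odd; at least two even gaps leave
    one after every deletion, while a single even gap [j] survives unless [a_j]
    or [a_(j+1)] is deleted, and the difference of those two terms telescopes to
    [T Phi_e].  For [q] odd the number of even gaps is even: with none, the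
    terms telescope to two full turns by steps of 2, i.e. to [N]; with exactly
    two, [j] and [k], each of [j], [k] remains the only even gap for two
    deletions of opposite sign; with more, every term vanishes. *)

(** * Arithmetic of the group ring and of sums of powers by steps of two *)

Section GroupRing.
Variables (R : comUnitRingType) (r : nat).
Implicit Types (x y : {ffun 'I_r -> R}) (t : 'I_r).

(** Only differences [F m - F n] with [m = n] mod 2 matter, so the starting
    point (2 or 3) is arbitrary. *)
Definition parity_sum (n : nat) : {ffun 'I_r -> R} :=
  \sum_(1 <= i < n./2.+1) rho_pow R r (odd n + 2 * i).

Lemma parity_sumSS n : parity_sum n.+2 = parity_sum n + rho_pow R r n.+2.
Proof.
rewrite /parity_sum /= negbK big_nat_recr //=; congr (_ + rho_pow _ _ _).
by lia.
Qed.

Lemma rho_powD k : rho_pow R r (k + r) = rho_pow R r k.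
Proof. by apply/ffunP => j; rewrite !ffunE modnDr. Qed.

Lemma sum_rho_pow a m :
  \sum_(1 <= i < m.+1) rho_pow R r (a + 2 * i)
  = parity_sum (a + 2 * m) - parity_sum a.
Proof.
elim: m => [|m IHm]; first by rewrite big_geq // muln0 addn0 subrr.
have -> : (a + 2 * m.+1 = (a + 2 * m).+2)%N by lia.
rewrite big_nat_recr //= IHm parity_sumSS addrAC.
by congr (_ + rho_pow _ _ _ - _); lia.
Qed.

(** Replacing [n] by [n + 2] adds the power [n + 2 + r] to one term and [n + 2] to the other. These
    are equal in the group ring, so the difference depends on the parity of [n] alone. This is what
    absorbs the shift by [r] whenever an index wraps round. *)
Lemma parity_sum_shift n m : odd n = odd m ->
  parity_sum (n + r) - parity_sum n = parity_sum (m + r) - parity_sum m.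
Proof.
have base k : parity_sum (k + r) - parity_sum k
    = parity_sum (odd k + r) - parity_sum (odd k).
  rewrite -{1 2}(odd_double_half k); elim: k./2 => [|h IHh]; first by rewrite addn0.
  have -> : (odd k + h.+1.*2 = (odd k + h.*2).+2)%N by lia.
  by rewrite !addSn !parity_sumSS -!addSn rho_powD -IHh opprD addrACA subrr addr0.
by move=> e; rewrite base e -base.
Qed.

Lemma phi_e_parity_sum a b : ~~ odd (dist r a b) ->
  phi_e R r a b = parity_sum (a + dist r a b) - parity_sum a.
Proof.
by move=> dE; rewrite /phi_e dE sum_rho_pow; congr (parity_sum _ - _); lia.
Qed.

(** The exponents have the form [a.+1 + 2 * i], and since the distance is odd the last one is
    [a + dist r a b]; hence the base point [a.+1]. *)
Lemma phi_o_parity_sum a b : odd (dist r a b) ->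
  phi_o R r a b = parity_sum (a + dist r a b) - parity_sum a.+1.
Proof.
move=> dO; rewrite /phi_o dO.
under eq_bigr => i _ do rewrite addn1 -addSn.
by rewrite sum_rho_pow; congr (parity_sum _ - _); lia.
Qed.

Lemma sum_coef_rho_pow k : (0 < r)%N -> \sum_t rho_pow R r k t = 1.
Proof.
move=> r0; have kr : (k %% r < r)%N by rewrite ltn_mod.
rewrite (bigD1 (Ordinal kr)) //= ffunE eqxx big1 ?addr0 // => j.
by rewrite ffunE -val_eqE /= => /negbTE ->.
Qed.

Lemma sum_coef_parity_sum n : (0 < r)%N -> \sum_t parity_sum n t = n./2%:R.
Proof.
move=> r0; under eq_bigr do rewrite sum_ffunE.
rewrite exchange_big /=; under eq_bigr do rewrite sum_coef_rho_pow //.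
by rewrite sumr_const_nat subn1.
Qed.

Lemma gmulDl x1 x2 y : gmul (x1 + x2) y = gmul x1 y + gmul x2 y.
Proof.
apply/ffunP => t; rewrite !ffunE -big_split /=; apply: eq_bigr => a _.
by rewrite -big_split /=; apply: eq_bigr => b _; rewrite !ffunE mulrDl.
Qed.

Lemma gmulDr x y1 y2 : gmul x (y1 + y2) = gmul x y1 + gmul x y2.
Proof.
apply/ffunP => t; rewrite !ffunE -big_split /=; apply: eq_bigr => a _.
by rewrite -big_split /=; apply: eq_bigr => b _; rewrite !ffunE mulrDr.
Qed.

Lemma gmulNr x y : gmul x (- y) = - gmul x y.
Proof.
apply/ffunP => t; rewrite !ffunE -sumrN; apply: eq_bigr => a _.
by rewrite -sumrN; apply: eq_bigr => b _; rewrite !ffunE mulrN.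
Qed.

Lemma gmul_scalel (k : R) x y : gmul (fscale k x) y = fscale k (gmul x y).
Proof.
apply/ffunP => t; rewrite !ffunE mulr_sumr; apply: eq_bigr => a _.
by rewrite mulr_sumr; apply: eq_bigr => b _; rewrite !ffunE mulrA.
Qed.

Lemma gmul0l y : gmul 0 y = 0.
Proof.
apply/ffunP => t; rewrite !ffunE big1 // => a _.
by rewrite big1 // => b _; rewrite ffunE mul0r.
Qed.

Lemma gmul_suml (I : Type) (s : seq I) (P : pred I) (F : I -> {ffun 'I_r -> R}) y :
  gmul (\sum_(i <- s | P i) F i) y = \sum_(i <- s | P i) gmul (F i) y.
Proof. by elim/big_rec2: _ => [|i u v _ <-]; rewrite ?gmul0l ?gmulDl. Qed.

Lemma gmul_rho_pow n m : (0 < r)%N ->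
  gmul (rho_pow R r n) (rho_pow R r m) = rho_pow R r (n + m).
Proof.
move=> r0; have lt k : (k %% r < r)%N by rewrite ltn_mod.
apply/ffunP => t; rewrite !ffunE (bigD1 (Ordinal (lt n))) //=.
rewrite [X in _ + X]big1 ?addr0; last first.
  move=> j; rewrite -val_eqE /= => /negbTE jn.
  by rewrite big1 // => b _; rewrite ffunE jn mul0r.
rewrite big_mkcond (bigD1 (Ordinal (lt m))) //= !ffunE !eqxx mulr1 modnDm.
rewrite [X in _ + X]big1 ?addr0; last first.
  move=> j; rewrite -val_eqE /= => /negbTE jm.
  by rewrite !ffunE jm mulr0 if_same.
by rewrite eq_sym; case: eqP.
Qed.

(** Multiplication by rho raises every exponent by one, so it shifts both end points of the
    difference of [parity_sum] values. *)
Lemma gmul_elT_phi_e a b : (0 < r)%N -> ~~ odd (dist r a b) ->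
  gmul (phi_e R r a b) (elT R r)
  = parity_sum (a + dist r a b).+1 - parity_sum a.+1
    - (parity_sum (a + dist r a b) - parity_sum a).
Proof.
move=> r0 dE; rewrite /elT gmulDr gmulNr -(phi_e_parity_sum dE).
rewrite /phi_e dE !gmul_suml; congr (_ - _); last first.
  by apply: eq_bigr => i _; rewrite gmul_rho_pow // addn0.
under eq_bigr do rewrite gmul_rho_pow // addn1 -addSn.
by rewrite sum_rho_pow; congr (parity_sum _ - _); lia.
Qed.

Lemma gmul_elN x : (0 < r)%N -> gmul x (elN R r) = [ffun=> \sum_t x t].
Proof.
move=> r0; apply/ffunP => t; rewrite !ffunE; apply: eq_bigr => a _.
(* For each [a] exactly one [b] satisfies [a + b = t] mod [r]; the summand [r] keeps the truncated
   subtraction exact. *)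
have bP : ((t + r - a) %% r < r)%N by rewrite ltn_mod.
rewrite (bigD1 (Ordinal bP)) /=; last first.
  rewrite modnDmr; have := ltn_ord a; have := ltn_ord t => tr ar.
  have -> : (a + (t + r - a) = t + r)%N by lia.
  by rewrite modnDr modn_small.
rewrite ffunE mulr1 big1 ?addr0 // => b /andP[/eqP abt /negP []].
apply/eqP/val_inj => /=; rewrite -abt.
have := ltn_ord a; have := ltn_ord b => br ar.
have [lt|ge] := ltnP (a + b) r.
  have e : (a + b + r - a = b + r)%N by lia.
  by rewrite (modn_small lt) e modnDr modn_small.
have -> : ((a + b) %% r = a + b - r)%N.
  by rewrite -{1}(subnK ge) modnDr modn_small //; lia.
have -> : (a + b - r + r - a = b)%N by lia.
by rewrite modn_small.
Qed.

End GroupRing.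

(** * Evaluating [Phi_e] and [Phi_o] from the set of even entries *)

Section EvenEntries.
Variables (R : comUnitRingType) (r : nat).
Implicit Type s : seq nat.

Lemma mem_even_entries s i :
  (i \in even_entries r s) = (i < size s)%N && ~~ odd (step r s i).
Proof. by rewrite mem_filter mem_iota andbC. Qed.

Lemma Phi_e_unique s j : (j < size s)%N -> ~~ odd (step r s j) ->
    (forall i, (i < size s)%N -> i != j -> odd (step r s i)) ->
  Phi_e R r s = fscale ((-1) ^+ j.+1) (phi_e R r (nth 0%N s j) (nxt s j)).
Proof.
move=> js jE others; rewrite /Phi_e.
have mem i : (i \in even_entries r s) = (i == j).
  rewrite mem_even_entries; have [->|ij] := eqVneq i j; first by rewrite js.
  by apply/negP => /andP[/others/(_ ij) ->].
have : perm_eq (even_entries r s) [:: j].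
  by apply: uniq_perm => [|//|i]; rewrite ?filter_uniq ?iota_uniq // mem mem_seq1.
by move/perm_small_eq => -> //.
Qed.

Lemma Phi_e_eq0 s i j : (i < size s)%N -> (j < size s)%N -> i != j ->
  ~~ odd (step r s i) -> ~~ odd (step r s j) -> Phi_e R r s = 0.
Proof.
move=> si sj ij iE jE; rewrite /Phi_e.
have : i \in even_entries r s by rewrite mem_even_entries si.
have : j \in even_entries r s by rewrite mem_even_entries sj.
case: (even_entries r s) => [|k [|//]] //; rewrite !inE => /eqP jk /eqP ik.
by rewrite ik jk eqxx in ij.
Qed.

Lemma Phi_o_all_odd s : (forall i, (i < size s)%N -> odd (step r s i)) ->
  Phi_o R r s = \sum_(j < size s) phi_o R r (nth 0%N s j) (nxt s j).
Proof.
move=> sO; rewrite /Phi_o ifT //; apply/eqP.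
case E: (even_entries r s) => [//|i e].
have : i \in even_entries r s by rewrite E mem_head.
by rewrite mem_even_entries => /andP[/sO ->].
Qed.

Lemma Phi_o_eq0 s i : (i < size s)%N -> ~~ odd (step r s i) -> Phi_o R r s = 0.
Proof.
move=> si iE; rewrite /Phi_o ifF //; apply/eqP => E.
by have := mem_even_entries s i; rewrite E si iE.
Qed.

End EvenEntries.

(** * Deleting an entry, and the gaps of the lifted sequence *)

Lemma dist_gt0 r a b : (a < r)%N -> (0 < dist r a b)%N.
Proof. by move=> ar; rewrite /dist; case: (ltnP a b) => ab; lia. Qed.

Definition del (T : Type) (i : nat) (s : seq T) : seq T := take i s ++ drop i.+1 s.

Lemma size_del (T : Type) i (s : seq T) : (i < size s)%N -> size (del i s) = (size s).-1.
Proof. by move=> si; rewrite size_cat size_drop size_takel; lia. Qed.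

Lemma nth_del (T : Type) (x0 : T) i (s : seq T) p : (i < size s)%N ->
  nth x0 (del i s) p = nth x0 s (bump i p).
Proof.
move=> si; rewrite nth_cat size_takel ?(ltnW si) // /bump.
have [pi|ip] := ltnP p i; first by rewrite nth_take.
by rewrite nth_drop; congr nth; lia.
Qed.

Section Unroll.
Variables (r : nat) (s : seq nat).
Local Notation q := (size s).

Definition unroll (i : nat) : nat := (nth 0 s (i %% q) + r * (i %/ q))%N.

(** Comparing the parities of the end points makes sense for every [i], and reduces the parity of a
    merged gap to a Boolean computation. *)
Definition even_gap (i : nat) : bool := odd (unroll i) == odd (unroll i.+1).

(** After deleting entry [i], a gap is still named by its starting entry [h] in
    [s]; it then ends at [gap_end i h]. *)
Definition gap_end (i h : nat) : nat := if (h.+1 %% q == i)%N then h.+2 else h.+1.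

Definition even_gap_del (i h : nat) : bool := odd (unroll h) == odd (unroll (gap_end i h)).

Lemma unroll_small h : (h < q)%N -> unroll h = nth 0%N s h.
Proof. by move=> hq; rewrite /unroll modn_small // divn_small // muln0 addn0. Qed.

Lemma unrollD i : (0 < q)%N -> unroll (i + q) = (unroll i + r)%N.
Proof. by move=> q0; rewrite /unroll modnDr divnDr // divnn q0; lia. Qed.

Lemma even_gapD i : (0 < q)%N -> even_gap (i + q) = even_gap i.
Proof. by move=> q0; rewrite /even_gap -addSn !unrollD // !(oddD _ r); do 3!case: odd. Qed.

Lemma even_gap_mod i : (0 < q)%N -> even_gap (i %% q) = even_gap i.
Proof.
move=> q0; rewrite {2}(divn_eq i q); elim: (i %/ q)%N => [|n IHn]; first by rewrite add0n.
by rewrite mulSn [(q + _)%N]addnC addnAC even_gapD.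
Qed.

Lemma even_gap_delE i h : (0 < q)%N -> even_gap_del i h =
  if (h.+1 %% q == i)%N then even_gap h == even_gap i else even_gap h.
Proof.
move=> q0; rewrite /even_gap_del /gap_end; case: (_ %% _ =P i)%N => // <-.
by rewrite even_gap_mod // /even_gap; do 3!case: odd.
Qed.

Lemma nxt_del i p : (i < q)%N -> (p < q.-1)%N ->
  nxt (del i s) p = nth 0%N s (gap_end i (bump i p) %% q).
Proof.
move=> iq pq; rewrite /nxt nth_del // size_del //; congr nth.
rewrite /gap_end; have [lt|pE] := ltnP p.+1 q.-1.
  rewrite (modn_small lt) /bump.
  have [ip|pi] := leqP i p.
    have -> : (true + p).+1 = p.+2 by [].
    rewrite leqW // (modn_small (_ : p.+2 < q)%N); last by lia.
    by rewrite ifF ?modn_small //; lia.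
  rewrite /= add0n.
  rewrite (modn_small (_ : p.+1 < q)%N) 1?[p.+1 == i]eq_sym; last by lia.
  by case: (i =P p.+1)%N => e; rewrite modn_small; lia.
(* Now [p] is the last position of the shortened sequence, so its successor wraps round: to entry 1
   of [s] if [i] is 0, to entry 0 otherwise. *)
have -> : p = q.-2 by lia.
have -> : (q.-2.+1 = q.-1)%N by lia.
rewrite modnn /bump.
have [i0|i0] := posnP i.
  have -> : ((i <= q.-2) + q.-2).+1 = q by lia.
  by rewrite i0 modnn eqxx -addn1 modnDl modn_small //; lia.
have -> : ((i <= 0) + 0)%N = 0%N by lia.
have [ip|pi] := leqP i q.-2.
  have -> : (true + q.-2).+1 = q by lia.
  by rewrite modnn ifF ?modnn //; lia.
have -> : (false + q.-2).+1 = q.-1 by lia.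
rewrite (modn_small (_ : q.-1 < q)%N) ?ifT; try lia.
have -> : q.-1.+1 = q by lia.
by rewrite modnn.
Qed.

(** An odd gap flips the parity of [unroll] and an even gap keeps it, so the two ends determine the
    number of odd gaps mod 2. Over a full turn the parity flips, as [r] is odd. *)
Lemma odd_even_gap_count n : 
  odd (\sum_(i < n) even_gap i) = odd (unroll n) (+) odd (unroll 0) (+) odd n.
Proof.
elim: n => [|n IHn]; first by rewrite big_ord0 addbb.
by rewrite big_ord_recr oddD IHn oddb /even_gap /=; do 4!case: odd.
Qed.

Lemma odd_even_gap_count_turn : odd r -> (0 < q)%N ->
  odd (\sum_(i < q) even_gap i) = ~~ odd q.
Proof.
move=> rO q0; rewrite odd_even_gap_count -[X in unroll X]add0n unrollD // oddD rO.
by do 2!case: odd.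
Qed.

Hypotheses (s_sorted : sorted ltn s) (s_lt : all (fun x => (x < r)%N) s).

(** Up to one turn, the lift advances by exactly the cyclic distance. The bound [e = h + q] is
    included because deleting one of two entries leaves a single gap, a full turn, and [dist] of a
    point to itself is [r]. *)
Lemma unroll_dist h e : (h < q)%N -> (h < e <= h + q)%N ->
  unroll e = (unroll h + dist r (nth 0 s h) (nth 0 s (e %% q)))%N.
Proof.
move=> hq /andP[he eh]; rewrite (unroll_small hq) /dist.
have lt i j : (i < j)%N -> (j < q)%N -> (nth 0 s i < nth 0 s j)%N.
  move=> ij jq; apply: (sorted_ltn_nth ltn_trans 0%N s_sorted) => //.
  by rewrite inE (ltn_trans ij).
have [eq|qe] := ltnP e q.
  by have l := lt _ _ he eq; rewrite modn_small // (unroll_small eq) l; lia.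
have ee : ((e - q) + q = e)%N by lia.
have q0 : (0 < q)%N by lia.
have sr := all_nthP 0%N s_lt.
have hr := sr h hq; have e'q : (e - q < q)%N by lia.
have er := sr _ e'q.
rewrite -ee unrollD // modnDr modn_small // (unroll_small e'q).
have : (nth 0 s (e - q) <= nth 0 s h)%N.
  by have [->|ne] := eqVneq (e - q)%N h; rewrite // ltnW // lt //; lia.
by rewrite leqNgt; case: ifP => // _ _; lia.
Qed.

Lemma unroll_step i : (i < q)%N -> unroll i.+1 = (nth 0 s i + step r s i)%N.
Proof. by move=> iq; rewrite (unroll_dist iq) ?unroll_small //; lia. Qed.

Lemma odd_step i : (i < q)%N -> odd (step r s i) = ~~ even_gap i.
Proof.
by move=> iq; rewrite /even_gap (unroll_step iq) unroll_small // oddD; do 2!case: odd.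
Qed.

Lemma unroll_lt i : (i < q)%N -> (unroll i < unroll i.+1)%N.
Proof.
move=> iq; rewrite (unroll_step iq) unroll_small // -addn1 leq_add2l.
exact/dist_gt0/(all_nthP 0%N s_lt).
Qed.

Lemma unroll_step_del i p : (i < q)%N -> (p < q.-1)%N ->
  unroll (gap_end i (bump i p)) = (nth 0 (del i s) p + step r (del i s) p)%N.
Proof.
move=> iq pq; rewrite /step nxt_del // nth_del //.
have bq : (bump i p < q)%N by rewrite /bump; lia.
rewrite (unroll_dist bq) ?unroll_small // /gap_end.
by case: eqP; lia.
Qed.

Lemma odd_step_del i p : (i < q)%N -> (p < q.-1)%N ->
  odd (step r (del i s) p) = ~~ even_gap_del i (bump i p).
Proof.
move=> iq pq; have bq : (bump i p < q)%N by rewrite /bump; lia.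
rewrite /even_gap_del unroll_step_del // (unroll_small bq) nth_del // oddD.
by do 2!case: odd.
Qed.

End Unroll.

(** * A full turn by steps of two gives the norm element *)

Section FullTurn.
Variables (R : comUnitRingType) (r : nat).

Lemma parity_sum_consecutive n :
  parity_sum R r n + parity_sum R r n.+1 = \sum_(2 <= k < n.+2) rho_pow R r k.
Proof.
elim: n => [|n IHn]; first by rewrite big_geq // /parity_sum !big_geq // addr0.
by rewrite big_nat_recr //= -IHn parity_sumSS addrCA addrA.
Qed.

Lemma sum_rho_pow_turn (t : 'I_r) : (1 < r)%N ->
  \sum_(2 <= k < r.+2) rho_pow R r k t = 1.
Proof.
move=> r1; rewrite !big_nat_recr //=; last by lia.
have := rho_powD R r 0; have := rho_powD R r 1; rewrite add0n add1n => -> ->.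
have : \sum_(0 <= k < r) rho_pow R r k t = 1.
  rewrite big_mkord (bigD1 t) //= ffunE modn_small // eqxx big1 ?addr0 // => j.
  by rewrite -val_eqE /= eq_sym => /negbTE jt; rewrite ffunE modn_small // jt.
rewrite (big_ltn (ltnW r1)) (big_ltn r1) => <-.
by ring.
Qed.

(** By [parity_sum_shift] the base points may be taken to be 0 and 1, where [parity_sum] vanishes.
    What remains is the sum at [r] and [r.+1], in which the two parity classes interleave to the [r]
    consecutive powers from 2 to [r.+1]. *)
Lemma parity_sum_turn (t : 'I_r) a b : odd r -> (1 < r)%N -> odd a != odd b ->
  parity_sum R r (a + r) t - parity_sum R r a t
  + (parity_sum R r (b + r) t - parity_sum R r b t) = 1.
Proof.
move=> rO r1.
have base c d : ~~ odd c -> odd d ->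
    parity_sum R r (c + r) t - parity_sum R r c t
    + (parity_sum R r (d + r) t - parity_sum R r d t) = 1.
  move=> cE dO; have /ffunP/(_ t) := @parity_sum_shift R r c 0 (negbTE cE).
  have /ffunP/(_ t) := @parity_sum_shift R r d 1 dO.
  have /ffunP/(_ t) := parity_sum_consecutive r.
  rewrite sum_ffunE sum_rho_pow_turn // !ffunE add0n add1n => <- -> ->.
  by rewrite /parity_sum ![\sum_(1 <= _ < 1) _]big_geq // !ffunE; ring.
by case aO: (odd a); case bO: (odd b) => // _; [rewrite addrC|]; apply: base; rewrite ?aO ?bO.
Qed.

End FullTurn.

(** * Reindexing of finite sums, and the successor mod [q] *)

Lemma sum_bump (V : zmodType) n i (G : nat -> V) : (i < n)%N ->
  \sum_(p < n.-1) G (bump i p) = \sum_(h < n) G h - G i.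
Proof.
case: n => // n lt_in; rewrite (bigD1_ord (Ordinal lt_in)) //=.
by rewrite addrAC subrr add0r.
Qed.

Lemma sum_two (V : nmodType) n (F : nat -> V) j k : (j < n)%N -> (k < n)%N -> j != k ->
  (forall i, (i < n)%N -> i != j -> i != k -> F i = 0) -> \sum_(i < n) F i = F j + F k.
Proof.
move=> jn kn jk F0; rewrite (bigD1 (Ordinal jn)) //= (bigD1 (Ordinal kn)) /=; last first.
  by rewrite -val_eqE /= eq_sym.
rewrite big1 ?addr0 // => i /andP[]; rewrite -!val_eqE /= => ij ik.
exact: F0.
Qed.

Lemma sum_cyclic_pred (V : nmodType) n (H : nat -> V) :
  \sum_(i < n) H (if i == 0 :> nat then n.-1 else i.-1) = \sum_(i < n) H i.
Proof. by case: n => [|n]; rewrite ?big_ord0 // big_ord_recl big_ord_recr addrC. Qed.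

Lemma succ_mod_inj q m n : (m < q)%N -> (n < q)%N -> m.+1 = n.+1 %[mod q] -> m = n.
Proof.
move=> mq nq /eqP; rewrite -(addn1 m) -(addn1 n) eqn_modDr (modn_small mq) (modn_small nq).
by move/eqP.
Qed.

Lemma succ_mod j q : (j < q)%N -> (j.+1 %% q = if j.+1 == q then 0 else j.+1)%N.
Proof. by move=> jq; case: eqP => [->|?]; rewrite ?modnn ?modn_small //; lia. Qed.

Lemma succ_mod_neq q j : (1 < q)%N -> (j < q)%N -> (j.+1 %% q)%N != j.
Proof. by move=> q1 jq; rewrite succ_mod //; case: ifP; lia. Qed.

Lemma unbump_lt q i h : (i < q)%N -> (h < q)%N -> h != i -> (unbump i h < q.-1)%N.
Proof. by rewrite /unbump; lia. Qed.

(** * Values of [Phi_e] and [Phi_o] after one deletion *)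

Section DelValues.
Variables (R : comUnitRingType) (r : nat) (s : seq nat) (t : 'I_r).
Hypotheses (s_sorted : sorted ltn s) (s_lt : all (fun x => (x < r)%N) s).
Local Notation q := (size s).
Local Notation a := (unroll r s).
Local Notation f n := (parity_sum R r n t).

Lemma f_shift m n : odd m = odd n -> f (m + r) - f m = f (n + r) - f n.
Proof. by move=> mn; have /ffunP/(_ t) := parity_sum_shift R r mn; rewrite !ffunE. Qed.

(** The surviving even gap [h] sits at position [h - (i < h)] of the shortened sequence. With the
    extra 1 in the sign of [Phi_e], and [h] different from [i], the total exponent is
    [i + h + (h < i)] mod 2. *)
Lemma Phi_e_del_unique i h : (i < q)%N -> (h < q)%N -> h != i -> even_gap_del r s i h ->
    (forall m, (m < q)%N -> m != i -> m != h -> ~~ even_gap_del r s i m) ->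
  (-1) ^+ i * Phi_e R r (del i s) t
  = (-1) ^+ (i + h + (h < i)) * (f (a (gap_end s i h)) - f (a h)).
Proof.
move=> iq hq hi hE others; have pq := unbump_lt iq hq hi.
have bp : bump i (unbump i h) = h by rewrite unbumpK.
have stepE : ~~ odd (step r (del i s) (unbump i h)).
  by rewrite odd_step_del // bp negbK.
rewrite (@Phi_e_unique _ _ _ (unbump i h)) ?size_del //; last first.
  move=> p pq' ph; rewrite odd_step_del //; apply: others.
  - by rewrite /bump; lia.
  - by rewrite eq_sym neq_bump.
  - by apply: contra ph => /eqP <-; rewrite bumpK.
rewrite ffunE phi_e_parity_sum // -[dist _ _ _]/(step r (del i s) (unbump i h)).
rewrite -unroll_step_del // bp !ffunE nth_del // bp -(unroll_small r hq).
rewrite mulrA -exprD; congr (_ * _).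
rewrite -signr_odd -[RHS]signr_odd; congr (_ ^+ nat_of_bool _).
by rewrite /unbump; case: (ltnP i h); case: (ltnP h i); lia.
Qed.

Lemma Phi_e_del_eq0 i h m : (i < q)%N -> (h < q)%N -> (m < q)%N -> h != i -> m != i ->
    h != m -> even_gap_del r s i h -> even_gap_del r s i m ->
  Phi_e R r (del i s) = 0.
Proof.
move=> iq hq mq hi mi hm hE mE.
have bh : bump i (unbump i h) = h by rewrite unbumpK.
have bm : bump i (unbump i m) = m by rewrite unbumpK.
apply: (@Phi_e_eq0 _ _ _ (unbump i h) (unbump i m)); rewrite ?size_del ?unbump_lt //.
- by apply: contra hm => /eqP e; rewrite -bh -bm e.
- by rewrite odd_step_del ?unbump_lt // bh negbK.
- by rewrite odd_step_del ?unbump_lt // bm negbK.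
Qed.

Lemma Phi_o_del_eq0 i h : (i < q)%N -> (h < q)%N -> h != i -> even_gap_del r s i h ->
  Phi_o R r (del i s) = 0.
Proof.
move=> iq hq hi hE; have bh : bump i (unbump i h) = h by rewrite unbumpK.
apply: (@Phi_o_eq0 _ _ _ (unbump i h)); rewrite ?size_del ?unbump_lt //.
by rewrite odd_step_del ?unbump_lt // bh negbK.
Qed.

(** Compared with the sum over all gaps of [s], the term of gap [i] disappears and the end of the
    preceding gap [l] moves one entry further. Indices stay in terms of [l] because for [i = 0] the
    lift of the merged gap ends beyond [q]. *)
Lemma Phi_o_del i l : (1 < q)%N -> (i < q)%N -> (l < q)%N -> (l.+1 %% q)%N = i ->
    (forall m, (m < q)%N -> m != i -> ~~ even_gap_del r s i m) ->
  Phi_o R r (del i s) t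
  = \sum_(h < q) (f (a h.+1) - f (a h).+1) - (f (a i.+1) - f (a i).+1)
    + (f (a l.+2) - f (a l.+1)).
Proof.
move=> q_gt1 iq lq li allO; have stepO p : (p < q.-1)%N -> odd (step r (del i s) p).
  move=> pq; rewrite odd_step_del //; apply: allO; last by rewrite eq_sym neq_bump.
  by rewrite /bump; lia.
have il : i != l by rewrite -li succ_mod_neq.
rewrite Phi_o_all_odd size_del // sum_ffunE.
under eq_bigr => p _.
  rewrite phi_o_parity_sum; last exact: stepO.
  rewrite -[dist _ _ _]/(step r (del i s) p) -unroll_step_del //.
  have bq : (bump i p < q)%N by rewrite /bump; have := ltn_ord p; lia.
  rewrite !ffunE nth_del // -(unroll_small r bq); over.
rewrite (@sum_bump _ q i (fun h => f (a (gap_end s i h)) - f (a h).+1)) //.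
have -> : \sum_(h < q) (f (a (gap_end s i h)) - f (a h).+1)
    = \sum_(h < q) (f (a h.+1) - f (a h).+1) + (f (a l.+2) - f (a l.+1)).
  rewrite [in LHS](bigD1 (Ordinal lq)) //= [in RHS](bigD1 (Ordinal lq)) //=.
  rewrite {1}/gap_end li eqxx (eq_bigr (fun h : 'I_q => f (a h.+1) - f (a h).+1)).
    by ring.
  move=> h; rewrite -val_eqE /= /gap_end; case: (_ %% _ =P i)%N => // e.
  by rewrite -li in e; rewrite (succ_mod_inj _ _ e) ?eqxx.
rewrite [gap_end s i i]/gap_end (negbTE (succ_mod_neq q_gt1 iq)).
by ring.
Qed.

End DelValues.

(** * Alternating sums over all deletions *)

Section DelSums.
Variables (R : comUnitRingType) (r : nat) (s : seq nat) (t : 'I_r).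
Hypotheses (s_sorted : sorted ltn s) (s_lt : all (fun x => (x < r)%N) s).
Hypothesis q_gt1 : (1 < size s)%N.
Local Notation q := (size s).
Local Notation a := (unroll r s).
Local Notation f n := (parity_sum R r n t).
Let q_gt0 : (0 < q)%N := ltnW q_gt1.

(** If gap [i] is even, every other even gap survives, since merging two even gaps gives an even
    one. If gap [i] is odd, only an even gap ending at entry [i] is lost, and [j] and [k] cannot
    both end there. *)
Lemma even_gap_survivor i j k : (i < q)%N -> (j < q)%N -> (k < q)%N -> j != k ->
    even_gap r s j -> even_gap r s k ->
  exists2 h, (h == j) || (h == k) & (h != i) && even_gap_del r s i h.
Proof.
move=> iq jq kq jk jE kE.
have surv h : (h < q)%N -> even_gap r s h -> h != i -> (h.+1 %% q != i)%N || even_gap r s i ->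
    (h != i) && even_gap_del r s i h.
  by move=> hq hE -> /=; rewrite even_gap_delE // hE; case: eqP => //= _ ->.
have [iE|iO] := boolP (even_gap r s i).
  have [ji|ji] := eqVneq j i.
    exists k; first by rewrite eqxx orbT.
    by apply: surv => //; [rewrite -ji eq_sym | rewrite iE orbT].
  by exists j; rewrite ?eqxx //; apply: surv; rewrite ?iE ?orbT.
have ne h : even_gap r s h -> h != i by apply: contraTneq => ->.
have [ji|ji] := eqVneq (j.+1 %% q)%N i; last first.
  by exists j; rewrite ?eqxx //; apply: surv; rewrite ?ji //; apply: ne.
exists k; first by rewrite eqxx orbT.
apply: surv; [by []|by []|exact: ne|].
rewrite -ji; apply/orP; left.
by apply: contra jk => /eqP/(succ_mod_inj kq jq) ->.
Qed.

(** Deleting either end point of the only even gap merges it with an odd neighbour. *)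
Lemma odd_gap_del_unique i j : (i < q)%N -> (j < q)%N -> even_gap r s j ->
    (forall m, (m < q)%N -> m != j -> ~~ even_gap r s m) ->
    (i == j) || (i == j.+1 %% q)%N ->
  forall m, (m < q)%N -> m != i -> ~~ even_gap_del r s i m.
Proof.
move=> iq jq jE others ij m mq mi; rewrite even_gap_delE //.
have [mm|mm] := eqVneq (m.+1 %% q)%N i.
  have [mj|mj] := eqVneq m j.
    by subst m; rewrite jE (negbTE (others i iq _)) // eq_sym.
  rewrite (negbTE (others m mq mj)); case/orP: ij => /eqP ij; first by rewrite ij jE.
  by rewrite ij in mm; rewrite (succ_mod_inj mq jq mm) eqxx in mj.
apply: others => //; apply: contra mm => /eqP mj.
by case/orP: ij => /eqP ij; [rewrite mj ij eqxx in mi | rewrite mj ij].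
Qed.

Lemma Phi_o_del_one_even i j : (i < q)%N -> (j < q)%N -> even_gap r s j ->
    (forall m, (m < q)%N -> m != j -> ~~ even_gap r s m) ->
    (i == j) || (i == j.+1 %% q)%N ->
  Phi_o R r (del i s) t = \sum_(h < q) (f (a h.+1) - f (a h).+1)
    + (if i == j then f (a j).+1 - f (a j) else f (a j.+1).+1 - f (a j.+1)).
Proof.
move=> iq jq jE others ij.
pose l := if i == 0%N then q.-1 else i.-1.
have lq : (l < q)%N by rewrite /l; case: ifP; lia.
have li : (l.+1 %% q)%N = i.
  by rewrite /l; case: eqP => [->|i0]; rewrite prednK ?modnn ?modn_small //; lia.
have allO := odd_gap_del_unique iq jq jE others ij.
rewrite (Phi_o_del R t s_sorted s_lt q_gt1 iq lq li allO) -!addrA; congr (_ + _).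
have [i0|i0] := eqVneq i 0%N; last first.
  have -> : l.+1 = i by rewrite /l; case: eqP; lia.
  have [<-|nij] := eqVneq i j; first by ring.
  have -> : j.+1 = i; last by ring.
  move: ij; rewrite (negbTE nij) /= succ_mod //.
  by case: ifP => _ /eqP ij; rewrite ij in i0 *.
(* For [i = 0] the merged gap lies one turn ahead. [f_shift] removes the turn, and its parity
   condition is that gap 0 is even if [j] is 0 and odd otherwise. *)
have l1 : l.+1 = q by rewrite /l i0 eqxx; lia.
have aq : a q = (a 0 + r)%N by rewrite -unrollD.
have aq1 : a q.+1 = (a 1 + r)%N by rewrite -unrollD.
rewrite l1 aq aq1 i0.
have [j0|nj0] := eqVneq 0%N j.
  move: jE; rewrite -j0 => /eqP e0.
  by rewrite (canRL (subrK _) (f_shift R t (esym e0))); ring.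
have -> : j.+1 = q.
  by move: ij; rewrite i0 (negbTE nj0) /= succ_mod //; case: (j.+1 =P q).
rewrite aq -addSn.
have := others 0%N q_gt0 nj0; rewrite /even_gap => o01.
have e : odd (a 1) = odd (a 0).+1 by move: o01 => /=; do 2!case: odd.
by rewrite (canRL (subrK _) (f_shift R t e)); ring.
Qed.

Lemma sum_del_Phi_o : odd r -> ~~ odd q ->
  \sum_(i < q) (-1) ^+ i * Phi_o R r (del i s) t = gmul (Phi_e R r s) (elT R r) t.
Proof.
move=> r_odd qE; have r_gt0 : (0 < r)%N := odd_gt0 r_odd.
have [/existsP[j jE]|] := boolP [exists j : 'I_q, even_gap r s j]; last first.
  rewrite negb_exists => /forallP allO.
  (* For even [q] the number of even gaps is odd, so it cannot be zero. *)
  have := odd_even_gap_count_turn r_odd q_gt0; rewrite qE big1 // => i _.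
  by rewrite (negbTE (allO i)).
have jq := ltn_ord j.
have [/existsP[k /andP[kj kE]]|] := boolP [exists k : 'I_q, (k != j) && even_gap r s k].
  rewrite (@Phi_e_eq0 _ _ _ j k) ?odd_step ?negbK //; last by rewrite eq_sym.
  rewrite gmul0l ffunE big1 // => i _.
  have kj' : (k : nat) != j by [].
  have [h hjk /andP[hi hE]] := even_gap_survivor (ltn_ord i) (ltn_ord k) jq kj' kE jE.
  have hq : (h < q)%N by case/orP: hjk => /eqP ->.
  by rewrite (Phi_o_del_eq0 R s_sorted s_lt (ltn_ord i) hq hi hE) ffunE mulr0.
rewrite negb_exists => /forallP others0.
have others m : (m < q)%N -> m != j -> ~~ even_gap r s m.
  by move=> mq mj; have := others0 (Ordinal mq); rewrite -val_eqE /= mj.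
have kq : (j.+1 %% q < q)%N by rewrite ltn_mod.
have kj := succ_mod_neq q_gt1 jq.
rewrite (@sum_two _ _ (fun i => (-1) ^+ i * Phi_o R r (del i s) t) _ _ jq kq); first last.
- move=> i iq ij ik; rewrite eq_sym in ij.
  rewrite (Phi_o_del_eq0 R s_sorted s_lt iq jq ij) ?ffunE ?mulr0 //.
  by rewrite even_gap_delE // eq_sym (negbTE ik).
- by rewrite eq_sym.
rewrite !(Phi_o_del_one_even _ jq jE others) ?eqxx ?orbT // (negbTE kj).
rewrite (@Phi_e_unique _ _ _ j) ?odd_step ?negbK //; last first.
  by move=> i iq ij; rewrite odd_step //; apply: others.
have stepE : ~~ odd (step r s j) by rewrite odd_step ?negbK.
rewrite gmul_scalel ffunE gmul_elT_phi_e // -[dist _ _ _]/(step r s j).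
rewrite -unroll_step // -(unroll_small r jq) !ffunE.
(* If gap [j] is the last one, the index wraps to 0 and the sign agrees because [q] is even. The two
   signs are thus opposite and the common sums over all gaps cancel. *)
have -> : (-1) ^+ (j.+1 %% q) = (-1) ^+ j.+1 :> R.
  rewrite succ_mod //; case: eqP => // ->.
  by rewrite -[RHS]signr_odd (negbTE qE).
by rewrite exprS; ring.
Qed.

(** For [k = i - 1] the exponent is [2 * i]; at the wrap it is [q.-1], again even. *)
Lemma cyclic_sign i k : odd q -> (k < q)%N -> (k.+1 %% q)%N = i ->
  (-1) ^+ (i + k + (k < i)) = 1 :> R.
Proof.
move=> qO kq ki; rewrite -signr_odd; suff -> : odd (i + k + (k < i)) = false by [].
by move: ki; rewrite succ_mod //; case: (k.+1 =P q) => e <-; rewrite ?ltn0 ?ltnSn; lia.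
Qed.

Lemma Phi_e_del_merged i k : odd q -> (i < q)%N -> (k < q)%N -> (k.+1 %% q)%N = i ->
    even_gap r s k == even_gap r s i ->
    (forall m, (m < q)%N -> m != i -> m != k -> ~~ even_gap r s m) ->
  (-1) ^+ i * Phi_e R r (del i s) t = f (a k.+2) - f (a k).
Proof.
move=> qO iq kq ki kiE others.
have ki' : k != i by rewrite eq_sym -ki succ_mod_neq.
rewrite (Phi_e_del_unique R t s_sorted s_lt iq kq ki'); first last.
- move=> m mq mi mk; rewrite even_gap_delE //.
  case: (_ %% _ =P i)%N => [e|_]; last exact: others.
  by rewrite -ki in e; rewrite (succ_mod_inj mq kq e) eqxx in mk.
- by rewrite even_gap_delE // ki eqxx.
by rewrite cyclic_sign // mul1r /gap_end ki eqxx.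
Qed.

Lemma sum_del_Phi_e_all_odd : odd r -> odd q ->
    (forall m, (m < q)%N -> ~~ even_gap r s m) ->
  \sum_(i < q) (-1) ^+ i * Phi_e R r (del i s) t = 1.
Proof.
move=> r_odd qO allO; pose l i := if i == 0 :> nat then q.-1 else i.-1.
rewrite (eq_bigr (fun i : 'I_q => f (a (l i).+2) - f (a (l i)))); last first.
  move=> i _; have iq := ltn_ord i.
  have lq : (l i < q)%N by rewrite /l; case: ifP; lia.
  apply: Phi_e_del_merged => //; last by move=> m mq _ _; apply: allO.
    by rewrite /l; case: eqP => [->|i0]; rewrite prednK ?modnn ?modn_small //; lia.
  by rewrite (negbTE (allO _ lq)) (negbTE (allO _ iq)).
rewrite (sum_cyclic_pred q (fun l => f (a l.+2) - f (a l))).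
rewrite -(big_mkord xpredT (fun l => f (a l.+2) - f (a l))).
(* Steps over two gaps telescope along sums of neighbouring values. The ends differ by one turn from
   [a 0] and one from [a 1], which have opposite parity. *)
rewrite (telescope_sumr_eq (fun l => f (a l.+1) + f (a l))) //; last by move=> k _; ring.
have -> : a q = (a 0 + r)%N by rewrite -unrollD.
have -> : a q.+1 = (a 1 + r)%N by rewrite -unrollD.
have r_gt1 : (1 < r)%N.
  have := unroll_lt s_sorted s_lt q_gt0; have := unroll_lt s_sorted s_lt q_gt1.
  have [r0|//|r1] := ltngtP r 1; first by have := ltn_ord t; lia.
  have x0 := all_nthP 0%N s_lt 0%N q_gt0; have x1 := all_nthP 0%N s_lt 1%N q_gt1.
  by rewrite !unroll_small //; lia.
rewrite -[RHS](@parity_sum_turn R r t (a 1) (a 0)) //; first by ring.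
by rewrite eq_sym; apply: allO.
Qed.

(** Deleting an end point of one even gap makes it odd and leaves the other. If [i] is a common end
    point, the merged gap is even and splits into both contributions, so the two conditional terms
    can be summed separately. If [i] touches neither gap, both survive and [Phi_e] vanishes. *)
Lemma Phi_e_del_two_even i j k : odd q -> (i < q)%N -> (j < q)%N -> (k < q)%N -> j != k ->
    even_gap r s j -> even_gap r s k ->
    (forall m, (m < q)%N -> m != j -> m != k -> ~~ even_gap r s m) ->
  (-1) ^+ i * Phi_e R r (del i s) t
  = (if (i == j) || (i == j.+1 %% q)%N
     then (-1) ^+ (i + k + (k < i)) * (f (a k.+1) - f (a k)) else 0)
  + (if (i == k) || (i == k.+1 %% q)%N
     then (-1) ^+ (i + j + (j < i)) * (f (a j.+1) - f (a j)) else 0).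
Proof.
move=> qO iq jq kq jk jE kE others.
have merged j' k' : (j' < q)%N -> (k' < q)%N -> even_gap r s j' -> even_gap r s k' ->
    (forall m, (m < q)%N -> m != j' -> m != k' -> ~~ even_gap r s m) ->
    i = j' -> (k'.+1 %% q)%N = i ->
    (-1) ^+ i * Phi_e R r (del i s) t
    = (-1) ^+ (i + k' + (k' < i)) * (f (a k'.+1) - f (a k'))
    + (-1) ^+ (i + j' + (j' < i)) * (f (a j'.+1) - f (a j')).
  move=> jq' kq' jE' kE' others' ij ki.
  rewrite (@Phi_e_del_merged i k') //; first last.
  - by move=> m mq mi; apply: others'; rewrite // -ij.
  - by rewrite kE' ij jE'.
  rewrite cyclic_sign // -ij ltnn addn0 addnn -signr_odd odd_double !mul1r.
  suff <- : f (a k'.+2) - f (a k'.+1) = f (a i.+1) - f (a i) by ring.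
  move: ki; rewrite succ_mod //; case: (k'.+1 =P q) => [-> i0|_ ->] //.
  have -> : a q = (a 0 + r)%N by rewrite -unrollD.
  have -> : a q.+1 = (a 1 + r)%N by rewrite -unrollD.
  have e : odd (a 1) = odd (a 0) by move: jE'; rewrite -ij -i0 => /eqP.
  by rewrite -i0 (canRL (subrK _) (f_shift R t e)); ring.
have single j' k' : (j' < q)%N -> (k' < q)%N -> j' != k' -> even_gap r s j' ->
    even_gap r s k' ->
    (forall m, (m < q)%N -> m != j' -> m != k' -> ~~ even_gap r s m) ->
    (i == j') || (i == j'.+1 %% q)%N -> (i == k') || (i == k'.+1 %% q)%N = false ->
    (-1) ^+ i * Phi_e R r (del i s) t
    = (-1) ^+ (i + k' + (k' < i)) * (f (a k'.+1) - f (a k')).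
  move=> jq' kq' jk' jE' kE' others' ij /norP[ik ik'].
  have ki : k' != i by rewrite eq_sym.
  rewrite (Phi_e_del_unique R t s_sorted s_lt iq kq' ki); first last.
  - move=> m mq mi mk; rewrite even_gap_delE //.
    have [mm|mm] := eqVneq (m.+1 %% q)%N i.
      have [mj|mj] := eqVneq m j'.
        by subst m; rewrite jE' (negbTE (others' i iq _ ik)) // eq_sym.
      rewrite (negbTE (others' m mq mj mk)); case/orP: ij => /eqP ij; first by rewrite ij jE'.
      by rewrite ij in mm; rewrite (succ_mod_inj mq jq' mm) eqxx in mj.
    apply: others' => //; apply: contra mm => /eqP mj.
    by case/orP: ij => /eqP ij; [rewrite mj ij eqxx in mi | rewrite mj ij].
  - by rewrite even_gap_delE // eq_sym (negbTE ik').
  by rewrite /gap_end eq_sym (negbTE ik').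
have others' m : (m < q)%N -> m != k -> m != j -> ~~ even_gap r s m.
  by move=> mq mk mj; apply: others.
have kj : k != j by rewrite eq_sym.
case ij: ((i == j) || (i == j.+1 %% q)%N); case ik: ((i == k) || (i == k.+1 %% q)%N).
- have [i_j|i_nj] := eqVneq i j.
    apply: (merged j k) => //; move: ik; rewrite i_j (negbTE jk) /=.
    by move/eqP.
  rewrite addrC; apply: (merged k j) => //.
    move: ij ik; rewrite (negbTE i_nj) /= => /eqP ij /orP[/eqP //|/eqP ik].
    by rewrite ij in ik; rewrite (succ_mod_inj jq kq ik) eqxx in jk.
  by move: ij; rewrite (negbTE i_nj) => /eqP.
- by rewrite addr0; apply: (single j k).
- by rewrite add0r; apply: (single k j).
move/norP: ij => [ij ij']; move/norP: ik => [ik ik'].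
rewrite addr0 (@Phi_e_del_eq0 _ _ _ s_sorted s_lt i j k) ?ffunE ?mulr0 //.
- by rewrite eq_sym.
- by rewrite eq_sym.
- by rewrite even_gap_delE // eq_sym (negbTE ij').
- by rewrite even_gap_delE // eq_sym (negbTE ik').
Qed.

(** The two end points of gap [j] carry opposite signs; at the wrap this uses that [q] is odd. *)
Lemma sum_adjacent_signs j k (c : R) : odd q -> (j < q)%N -> (k < q)%N -> j != k ->
  \sum_(i < q) (if (i == j :> nat) || (i == j.+1 %% q :> nat)%N
                then (-1) ^+ (i + k + (k < i)) * c else 0) = 0.
Proof.
move=> qO jq kq jk; have nq : (j.+1 %% q < q)%N by rewrite ltn_mod.
have nj := succ_mod_neq q_gt1 jq; rewrite eq_sym in nj.
rewrite (sum_two (F := fun i : nat => if (i == j) || (i == j.+1 %% q)%N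
    then (-1) ^+ (i + k + (k < i)) * c else 0) jq nq nj); last first.
  by move=> i iq /negbTE -> /negbTE ->.
rewrite !eqxx orbT /= -mulrDl -signr_odd -[_ ^+ (_ %% _ + _ + _)%N]signr_odd.
have -> : odd (j.+1 %% q + k + (k < j.+1 %% q)) = ~~ odd (j + k + (k < j)).
  by rewrite succ_mod //; case: (j.+1 =P q) => e; lia.
by rewrite signrN subrr mul0r.
Qed.

Lemma sum_del_Phi_e_even_gap j : odd r -> odd q -> (j < q)%N -> even_gap r s j ->
  \sum_(i < q) (-1) ^+ i * Phi_e R r (del i s) t = 0.
Proof.
move=> r_odd qO jq jE.
have [/existsP[k /andP[kj kE]]|] := boolP [exists k : 'I_q, (k != j :> nat) && even_gap r s k];
  last first.
  rewrite negb_exists => /forallP others0.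
  have := odd_even_gap_count_turn r_odd q_gt0; rewrite (bigD1 (Ordinal jq)) //= jE big1 ?qO //.
  move=> i; rewrite -val_eqE /= => ij.
  by have := others0 i; rewrite ij /= => /negbTE ->.
have kq := ltn_ord k.
have [/existsP[l /and3P[lj lk lE]]|] :=
  boolP [exists l : 'I_q, [&& l != j :> nat, l != k :> nat & even_gap r s l]].
  rewrite big1 // => i _; have iq := ltn_ord i; have lq := ltn_ord l.
  have two x y : (x < q)%N -> (y < q)%N -> x != y -> (x != i) && even_gap_del r s i x ->
      (y != i) && even_gap_del r s i y -> (-1) ^+ i * Phi_e R r (del i s) t = 0.
    move=> xq yq xy /andP[xi xE] /andP[yi yE].
    by rewrite (Phi_e_del_eq0 R s_sorted s_lt iq xq yq xi yi xy xE yE) ffunE mulr0.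
  (* One of [j], [k] survives; the other one paired with [l] yields a second survivor, so [Phi_e]
     vanishes. *)
  have [x /orP[] /eqP -> xE] := even_gap_survivor iq kq jq kj kE jE.
    have [y /orP[] /eqP -> yE] := even_gap_survivor iq lq jq lj lE jE.
      exact: two lq kq lk yE xE.
    exact: two kq jq kj xE yE.
  have [y /orP[] /eqP -> yE] := even_gap_survivor iq lq kq lk lE kE.
    exact: two lq jq lj yE xE.
  exact: two kq jq kj yE xE.
rewrite negb_exists => /forallP others0.
have others m : (m < q)%N -> m != j -> m != k -> ~~ even_gap r s m.
  by move=> mq mj mk; have := others0 (Ordinal mq); rewrite /= mj mk.
have jk : j != k by rewrite eq_sym.
under eq_bigr => i _ do rewrite (Phi_e_del_two_even qO (ltn_ord i) jq kq jk jE kE others).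
by rewrite big_split /= !sum_adjacent_signs ?addr0.
Qed.

End DelSums.

(** * The chain map identity for increasing sequences *)

Section ChainMapSeq.
Variables (R : comUnitRingType) (r : nat) (s : seq nat).
Hypotheses (s_sorted : sorted ltn s) (s_lt : all (fun x => (x < r)%N) s).
Hypothesis r_odd : odd r.
Local Notation q := (size s).
Local Notation a := (unroll r s).

Let r_gt0 : (0 < r)%N := odd_gt0 r_odd.

Lemma sum_coef_Phi_o : (0 < q)%N -> (forall m, (m < q)%N -> ~~ even_gap r s m) ->
  \sum_t Phi_o R r s t = ((r - q)./2)%:R.
Proof.
move=> q_gt0 allO; have stepO m : (m < q)%N -> odd (step r s m).
  by move=> mq; rewrite odd_step // allO.
rewrite Phi_o_all_odd //; under eq_bigr do rewrite sum_ffunE.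
rewrite exchange_big /=.
under eq_bigr => h _.
  rewrite phi_o_parity_sum; last exact: stepO.
  rewrite -[dist _ _ _]/(step r s h) -unroll_step // -(unroll_small r (ltn_ord h)).
  under eq_bigr do rewrite !ffunE.
  rewrite sumrB !sum_coef_parity_sum //; over.
(* The inequality makes the truncated subtractions exact, and the parity makes the halving exact at
   each step. *)
have partial m : (m <= q)%N -> [/\ (a 0 + m <= a m)%N, odd (a m) = odd (a 0 + m) &
    \sum_(h < m) ((a h.+1)./2%:R - (a h).+1./2%:R) = ((a m - a 0 - m)./2)%:R :> R].
  elim: m => [_|m IHm mq]; first by rewrite big_ord0 subn0 subnn addn0.
  have [le par sum] := IHm (ltnW mq); have lt := unroll_lt s_sorted s_lt mq.
  have par' : odd (a m.+1) = ~~ odd (a m).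
    by move: (allO m mq); rewrite /even_gap; do 2!case: odd.
  split; [by lia | by rewrite par' par; lia |].
  rewrite big_ord_recr /= sum -natrB; last by lia.
  by rewrite -natrD; congr (_%:R); lia.
have [_ _ ->] := partial q (leqnn q).
have -> : a q = (a 0 + r)%N by rewrite -unrollD.
by rewrite addKn.
Qed.

Lemma Phi_seq_chain_map : (1 < q)%N -> (q < r)%N ->
  \sum_(i < q) fscale ((-1) ^+ i) (Phi_seq R r (del i s)) = dW q (Phi_seq R r s).
Proof.
move=> q_gt1 qr; have q_gt0 := ltnW q_gt1.
apply/ffunP => t; rewrite sum_ffunE /dW /Phi_seq gmul_scalel [RHS]ffunE.
have sz (i : 'I_q) : size (del i s) = q.-1 by rewrite size_del.
under eq_bigr do rewrite !ffunE sz mulrCA.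
rewrite -mulr_sumr; case qO: (odd q); last first.
  have -> : odd q.-1 by lia.
  (* Here [r - q] is odd, so lowering [q] by one does not change the floor. *)
  have -> : varphi r q.-1 = varphi r q by rewrite /varphi; lia.
  by rewrite sum_del_Phi_o ?qO.
have -> : odd q.-1 = false by lia.
rewrite gmul_elN // ffunE.
have [/existsP[j jE]|] := boolP [exists j : 'I_q, even_gap r s j].
  rewrite (@sum_del_Phi_e_even_gap _ _ _ _ _ _ _ j) //.
  rewrite (@Phi_o_eq0 _ _ _ j) ?odd_step ?negbK //.
  by rewrite [X in _ = _ * X]big1 ?mulr0 // => i _; rewrite ffunE.
rewrite negb_exists => /forallP allO0.
have allO m : (m < q)%N -> ~~ even_gap r s m by move=> mq; exact: (allO0 (Ordinal mq)).
rewrite sum_del_Phi_e_all_odd // sum_coef_Phi_o // mulr1.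
(* Here [r - q] is even and positive. The coefficient sum [(r - q)./2] of [Phi_o] is the extra
   factor between the two factorials. *)
have -> : varphi r q.-1 = (varphi r q).+1 by rewrite /varphi; lia.
have -> : (r - q)./2 = (varphi r q).+1 by rewrite /varphi; lia.
by rewrite factS natrM -mulrA mulrC.
Qed.

End ChainMapSeq.

(** * From sequences to chains on subsets *)

Section ChainMap.
Variables (R : comUnitRingType) (r : nat).
Implicit Types (A B : {set 'I_r}) (c : {ffun {set 'I_r} -> R}).

Lemma sorted_enum_set A : sorted ltn [seq val x | x <- enum A].
Proof.
apply: (subseq_sorted ltn_trans _ (iota_ltn_sorted 0 r)).
rewrite -val_enum_ord map_subseq // [enum 'I_r]enumT.
exact: filter_subseq.
Qed.

Lemma enum_setD1 A i : (i < #|A|)%N -> forall x0,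
  enum (A :\ nth x0 (enum A) i) = del i (enum A).
Proof.
rewrite cardE => iA x0; have uA := enum_uniq (mem A).
rewrite -[X in del X](index_uniq x0 iA uA) /del -remE rem_filter //.
rewrite /enum_mem -filter_predI; apply: eq_filter => y.
by rewrite /= !inE.
Qed.

Lemma map_del (T U : Type) (g : T -> U) i (l : seq T) : map g (del i l) = del i (map g l).
Proof. by rewrite /del map_cat map_take map_drop. Qed.

Lemma sum_faces_Phi_gen A : odd r -> (1 < #|A| < r)%N ->
  \sum_(x in A) fscale ((-1) ^+ index x (enum A)) (Phi_gen R (A :\ x))
  = dW #|A| (Phi_gen R A).
Proof.
move=> r_odd /andP[A1 Ar]; have [x0 _] : exists x, x \in A by apply/card_gt0P; apply: ltnW.
have sA : size [seq val x | x <- enum A] = #|A| by rewrite size_map cardE.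
have A_lt : all (fun y => (y < r)%N) [seq val x | x <- enum A].
  by rewrite all_map; apply/allP => x _ /=; apply: ltn_ord.
have := Phi_seq_chain_map R (sorted_enum_set A) A_lt r_odd.
rewrite sA => <- //; rewrite -big_enum (big_nth x0) -cardE big_mkord; apply: eq_bigr => i _.
rewrite index_uniq ?enum_uniq -?cardE //.
by rewrite /Phi_gen enum_setD1 // map_del.
Qed.

Lemma Phi_dN q c (t : 'I_r) :
  Phi q.-1 (dN q c) t
  = \sum_(A : {set 'I_r} | #|A| == q)
      c A * (\sum_(x in A) fscale ((-1) ^+ index x (enum A)) (Phi_gen R (A :\ x))) t.
Proof.
rewrite /Phi /dN sum_ffunE.
under eq_bigr do rewrite ffunE sum_ffunE mulr_suml.
rewrite exchange_big /=; apply: eq_bigr => A /eqP cA.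
under eq_bigr do rewrite ffunE -mulrA.
rewrite -mulr_sumr; congr (_ * _).
under [LHS]eq_bigr => B _ do rewrite /bdN sum_ffunE mulr_suml.
rewrite exchange_big /= sum_ffunE; apply: eq_bigr => x xA.
(* Only the face [A :\ x] itself contributes to the sum over [B]. *)
rewrite (bigD1 (A :\ x)) /=; last by have := cardsD1 x A; rewrite xA cA => ->.
rewrite !ffunE eqxx mulr1 big1 ?addr0 // => B /andP[_ /negbTE Bx].
by rewrite !ffunE Bx mulr0 mul0r.
Qed.

Lemma dW_Phi q c (t : 'I_r) :
  dW q (Phi q c) t = \sum_(A : {set 'I_r} | #|A| == q) c A * dW q (Phi_gen R A) t.
Proof.
rewrite /dW /Phi gmul_suml sum_ffunE; apply: eq_bigr => A _.
by rewrite gmul_scalel ffunE.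
Qed.

(** The single gap is a full turn of odd length [r], with coefficient sum [rtilde r]. As
    [varphi r 1] is one less, the numerator completes to the factorial of [rtilde r], which cancels
    because it is a unit. *)
Lemma sum_coef_Phi_gen1 (x : 'I_r) : (1 < r)%N -> odd r ->
  ((rtilde r)`!)%:R \is a @GRing.unit R -> dW1 (Phi_gen R [set x]) = 1.
Proof.
move=> r_gt1 r_odd ft; rewrite /dW1 /Phi_gen enum_set1 /= /Phi_seq /=.
under eq_bigr do rewrite ffunE.
rewrite -mulr_sumr sum_coef_Phi_o //=; last first.
- case=> // _; rewrite /even_gap -[1%N]/(0 + size [:: val x])%N unrollD // oddD r_odd.
  by case: odd.
- by rewrite ltn_ord.
have -> : (r - 1)./2 = rtilde r by rewrite /rtilde subn1.
have e : rtilde r = (varphi r 1).+1 by rewrite /rtilde /varphi; lia.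
by rewrite mulrAC -natrM mulnC {1}e -factS -e divrr.
Qed.

Lemma Phi_dN1 c : (1 < r)%N -> odd r -> ((rtilde r)`!)%:R \is a @GRing.unit R ->
  Phi0 (dN 1 c) = dW1 (Phi 1 c).
Proof.
move=> r_gt1 r_odd ft; rewrite /Phi0 /dN /dW1 /Phi sum_ffunE.
under [RHS]eq_bigr do rewrite sum_ffunE.
rewrite [RHS]exchange_big /=; apply: eq_bigr => A /cards1P[x ->].
under [RHS]eq_bigr do rewrite ffunE.
rewrite -mulr_sumr -/(dW1 _) (sum_coef_Phi_gen1 x r_gt1 r_odd ft) ffunE; congr (_ * _).
rewrite /bdN big_set1 !ffunE enum_set1 /= eqxx expr0 mul1r.
by rewrite setDv eqxx.
Qed.

End ChainMap.

Theorem theorem5p1 (R : comUnitRingType) (r : nat) :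
  (3 <= r)%N -> odd r -> ((rtilde r)`!)%:R \is a @GRing.unit R ->
  (forall c : {ffun {set 'I_r} -> R}, Phi0 (dN 1 c) = dW1 (Phi 1 c)) /\
  (forall q : nat, (2 <= q <= r.-1)%N ->
     forall c : {ffun {set 'I_r} -> R}, Phi q.-1 (dN q c) = dW q (Phi q c)).
Proof.
move=> r_ge3 r_odd ft; split=> [c|q /andP[q2 qr] c].
  by apply: Phi_dN1 => //; apply: ltnW.
apply/ffunP => t; rewrite Phi_dN dW_Phi; apply: eq_bigr => A /eqP cA.
by rewrite sum_faces_Phi_gen ?cA //; lia.
Qed.
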